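(* Let $g$ be a positive integer. There exists a $\mathrm{GDD}(4,5,6g+3g)$ of type $g^{6}(3g)^1$ if and only if $g$ is divisible by $3$.
   Context: A group divisible design $\mathrm{GDD}(t,k,m)$ of type $g_1^{n_1} g_2^{n_2}\cdots g_r^{n_r}$, where $t \ge 2$ and $m=\sum_{i=1}^r n_i g_i$, is a triple $(X,G,B)$ such that $X$ is a set of $m$ points; $G$ is a partition of $X$ into $n=\sum_{i=1}^r n_i$ groups, of which $n_i$ have exactly $g_i$ points, $1\le i\le r$; $B$ is a set of $k$-subsets of $X$ (blocks); each block contains at most one point from each group; and each $t$-subset of $X$ which contains at most one point from each group is contained in exactly one block of $B$. *)

(* Defs.v *)
From mathcomp Require Import all_boot.

Set Implicit Arguments.
Unset Strict Implicit.
Unset Printing Implicit Defensive.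

(* A type g_1^n_1 ... g_r^n_r is the list [:: (g_1, n_1); ...; (g_r, n_r)]
   of (group size, multiplicity) pairs; [type_sizes ty] is the list of all
   the group sizes, each repeated according to its multiplicity. *)
Definition gdd_type := seq (nat * nat).

Definition type_sizes (ty : gdd_type) : seq nat :=
  flatten [seq nseq p.2 p.1 | p <- ty].

Section GroupDivisibleDesign.

Variable X : finType.
Implicit Types (G B : {set {set X}}) (S : {set X}).

Definition transverse G S : Prop :=
  forall A : {set X}, A \in G -> #|S :&: A| <= 1.

Record is_gdd (t k m : nat) (ty : gdd_type) G B : Prop := IsGDD {
  gdd_t_ge2 : 2 <= t;
  gdd_order : m = \sum_(p <- ty) p.2 * p.1;
  gdd_points : #|X| = m;
  gdd_partition : partition G [set: X];
  gdd_group_sizes : perm_eq [seq #|A : {set X}| | A <- enum G] (type_sizes ty);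
  gdd_block_size : forall b : {set X}, b \in B -> #|b| = k;
  gdd_block_transverse : forall b : {set X}, b \in B -> transverse G b;
  gdd_cover : forall S, #|S| = t -> transverse G S ->
    exists! b : {set X}, b \in B /\ S \subset b
}.

End GroupDivisibleDesign.

Definition gdd_exists (t k m : nat) (ty : gdd_type) : Prop :=
  exists (X : finType) (G B : {set {set X}}), is_gdd t k m ty G B.

(* Main.v *)
Require Import Defs.
From mathcomp Require Import all_boot all_algebra zify.

(** Necessity.  Fix a point [x] of the large group and a point [y] of a small
    one.  The ordered pairs [(p, q)] for which [x, y, p, q] lie in four
    different groups number [5g * 4g].  Each of them lies, together with [x]
    and [y], in exactly one block, and a block through [x] and [y] has three
    further points, hence accounts for 6 pairs ([dvdn_completing_pairs]).  So
    6 divides [20 g^2], and 3 divides [g].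

    Sufficiency.  A design with block size [t + 1] can be inflated: every point
    is replaced by copies indexed by a finite abelian group [V], and every block
    by its lifts whose [V]-coordinates sum to 0; such a lift is determined by
    any [t] of its points ([is_gdd_inflate]).  It therefore suffices to
    construct one design, of type [3^6 9^1] ([gdd_3_6_9_1]).

    Take three copies [P], [Q], [R] of the integers modulo 9.  The large group
    is [R]; the small groups are the residue classes modulo 3 in [P] and in [Q].
    A transverse triple in [P] is then an arithmetic progression
    [{m - d, m, m + d}] with [d] a unit, unique up to sign, and a transverse
    pair has the form [{m - d, m + d}]; thus every transverse 4-set in [P] and
    [Q] has a centre [m] in [P], a centre [n] in [Q], and one or two half-
    differences among 1, 4, 7 up to sign.  Such a 4-set is completed to a block
    by the point [m + n + c] of [R], where [c] depends only on the sizes of the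
    two parts and on the half-differences, and is multiplied by [s] when the
    half-differences are, for [s] = 1, 4, 7.  Up to the
    maps [(x, y, z) -> (sx + u, sy + v, sz + u + v)], which form a group of
    order 243, five base blocks remain.

    These blocks form a design if the nine points that extend a transverse
    triple of small points to a transverse 4-set of small points lead to nine
    different points of [R].  For the triple with [P]-part [{-1, 1}] and
    [Q]-part [{0}], the extensions inside [P] give 0, 1, 8 and those inside
    [Q] give [6 +- 1], [8 +- 4], [4 +- 7].  For the [P]-part [{0}] and the
    [Q]-part [{-1, 1}], they give 1, 6, 8 inside [Q], and [6 +- 1], [7 +- 4],
    [2 +- 7] inside [P].  For a triple inside [P] or inside [Q] the added point
    itself runs through all residues.  Symmetry reduces every triple to one of
    these.  The covering property is established below by evaluation
    ([developed_blocks_cover]). *)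

Set Implicit Arguments.
Unset Strict Implicit.
Unset Printing Implicit Defensive.

Import GRing.Theory.

(** * Finite sets, transversality and counting pairs *)

Lemma perm_enum_imset (T U : finType) (f : T -> U) (A : {set T}) :
  injective f -> perm_eq (enum (f @: A)) [seq f x | x <- enum A].
Proof.
move=> injf; apply: uniq_perm; first exact: enum_uniq.
  by rewrite map_inj_uniq ?enum_uniq.
move=> y; rewrite mem_enum; apply/imsetP/mapP => -[x xA ->]; exists x => //.
  by rewrite mem_enum.
by rewrite -mem_enum.
Qed.

Lemma uniq_map_inj_in (T U : eqType) (f : T -> U) (s : seq T) :
  uniq (map f s) -> {in s &, injective f}.
Proof.
elim: s => [|a s IH] //= /andP[nfa us] x y; rewrite !inE.
case/predU1P=> [->|xs] /predU1P[->|ys] // fxy; last exact: IH.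
  by rewrite fxy map_f in nfa.
by rewrite -fxy map_f in nfa.
Qed.

Section Transverse.

Variables (X : finType) (G : {set {set X}}).
Hypothesis partG : partition G [set: X].

Lemma pblock_group x : pblock G x \in G.
Proof. by apply: pblock_mem; rewrite (cover_partition partG). Qed.

Lemma in_pblock x : x \in pblock G x.
Proof. by rewrite mem_pblock (cover_partition partG). Qed.

Lemma group_pblock (A : {set X}) x : A \in G -> x \in A -> pblock G x = A.
Proof. by apply: def_pblock; case/and3P: partG. Qed.

Lemma transverseP (S : {set X}) :
  transverse G S <-> {in S &, injective (pblock G)}.
Proof.
split=> [trS x y xS yS exy | injS A AG].
  apply: (card_le1_eqP (trS _ (pblock_group x))); rewrite !inE.
    by rewrite yS exy in_pblock.
  by rewrite xS in_pblock.
apply/card_le1_eqP => x y; rewrite !inE => /andP[xS xA] /andP[yS yA].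
by apply: injS => //; rewrite !(group_pblock AG).
Qed.

End Transverse.

Lemma card_dep_pairs (T U : finType) (P : pred T) (Q : T -> pred U) :
  #|[set p : T * U | P p.1 && Q p.1 p.2]| = \sum_(x | P x) #|[set y | Q x y]|.
Proof.
rewrite -sum1_card; under [RHS]eq_bigr do rewrite -sum1_card.
rewrite pair_big_dep; apply: eq_bigl => p /=.
by rewrite !inE.
Qed.

Lemma card_offdiag_pairs (X : finType) (b : {set X}) :
  #|[set p | [&& p.1 \in b, p.2 \in b & p.1 != p.2]]| = #|b| * #|b|.-1.
Proof.
rewrite (card_dep_pairs (mem b) (fun u v => (v \in b) && (u != v))).
rewrite -sum_nat_const; apply: eq_bigr => u ub.
rewrite (cardsD1 u b) (ub : u \in b) /=; apply: eq_card => v.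
by rewrite !inE andbC eq_sym.
Qed.


(** * Necessity: counting pairs through two points *)

Section Divisibility.

Variables (X : finType) (G B : {set {set X}}) (m : nat) (ty : gdd_type).
Hypothesis gddX : is_gdd 4 5 m ty G B.

Lemma pairs_in_block x y b : b \in B -> x \in b -> y \in b -> x != y ->
  #|[set p : X * X | uniq [seq pblock G z | z <- [:: x; y; p.1; p.2]]
                     && ([set z in [:: x; y; p.1; p.2]] \subset b)]| = 6.
Proof.
move=> bB xb yb xy; set D := [set p | _].
have partG := gdd_partition gddX.
have cardc : #|b :\ x :\ y| = 3.
  have := gdd_block_size gddX bB; rewrite (cardsD1 x) xb (cardsD1 y).
  by rewrite !inE yb eq_sym xy /= => -[].
have -> : D = [set p | [&& p.1 \in b :\ x :\ y, p.2 \in b :\ x :\ y & p.1 != p.2]].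
  apply/setP => -[u v]; rewrite !inE.
  have -> : ([set z in [:: x; y; u; v]] \subset b) = (u \in b) && (v \in b).
    apply/subsetP/andP => [sub | [ub vb] z].
      by split; apply: sub; rewrite !inE eqxx ?orbT.
    by rewrite !inE => /or4P[] /eqP->.
  have [ub|] := boolP (u \in b); last by rewrite !andbF.
  have [vb|] := boolP (v \in b); last by rewrite !andbF.
  have -> : uniq [seq pblock G z | z <- [:: x; y; u; v]] = uniq [:: x; y; u; v].
    apply: map_inj_in_uniq => z w; rewrite !inE => zs ws.
    have inb a : [|| a == x, a == y, a == u | a == v] -> a \in b by case/or4P=> /eqP->.
    move: (inb z zs) (inb w ws).
    exact: (iffLR (transverseP partG b) (gdd_block_transverse gddX bB)).
  rewrite /= !inE !negb_or xy !andbT /= ![_ == x]eq_sym ![_ == y]eq_sym.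
  by case: (x == u); case: (x == v); case: (y == u); case: (y == v).
by rewrite card_offdiag_pairs cardc.
Qed.

(** Double counting: by the covering axiom each completing pair lies in exactly
    one block through [x] and [y], and each such block contains six of them. *)
Lemma dvdn_completing_pairs x y : pblock G x != pblock G y ->
  6 %| #|[set p : X * X | uniq [seq pblock G z | z <- [:: x; y; p.1; p.2]]]|.
Proof.
move=> nxy; set D := [set p | _].
have partG := gdd_partition gddX.
pose S (p : X * X) := [set z in [:: x; y; p.1; p.2]].
have one p : p \in D -> \sum_(b in B | S p \subset b) 1 = 1.
  rewrite inE => uD.
  have cS : #|S p| = 4.
    by rewrite cardsE; apply/card_uniqP: (map_uniq uD).
  have trS : transverse G (S p).
    apply/(transverseP partG) => u v; rewrite !in_set => us vs.
    exact: (uniq_map_inj_in uD).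
  have [b [[bB sb] ub]] := gdd_cover gddX cS trS.
  rewrite (bigD1 b) ?bB //= big1 // => c /andP[/andP[cB sc]].
  by rewrite (ub c) ?eqxx.
rewrite -sum1_card -(eq_bigr _ one).
rewrite (exchange_big_dep (fun b => [&& b \in B, x \in b & y \in b])) /=; last first.
  move=> p b _ /andP[-> /subsetP sb].
  by rewrite !sb // !inE eqxx ?orbT.
apply: dvdn_sum => b /and3P[bB xb yb]; rewrite sum1dep_card.
have xy : x != y by apply: contraNneq nxy => ->.
rewrite [X in _ %| X](_ : _ = 6) // -(pairs_in_block bB xb yb xy).
by apply: eq_card => p; rewrite !inE bB.
Qed.

End Divisibility.

Lemma one_big_group (X : finType) (G B : {set {set X}}) (t k m g h n : nat) :
  is_gdd t k m [:: (g, n); (h, 1)] G B ->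
  exists2 A0, A0 \in G /\ #|A0| = h & {in G, forall A, A != A0 -> #|A| = g}.
Proof.
move=> gddX; have := gdd_group_sizes gddX; rewrite /type_sizes /= => sizesG.
have /mapP[A0] : h \in [seq #|A : {set X}| | A <- enum G].
  by rewrite (perm_mem sizesG) mem_cat mem_head orbT.
rewrite mem_enum => A0G hA0; exists A0 => // A AG nA.
have A0e : A0 \in enum G by rewrite mem_enum.
have : #|A| \in [seq #|C : {set X}| | C <- rem A0 (enum G)].
  by apply: map_f; rewrite mem_rem_uniq ?enum_uniq // !inE nA mem_enum.
have := perm_map (fun C : {set X} => #|C|) (perm_to_rem A0e).
rewrite perm_sym => /perm_trans/(_ sizesG); rewrite perm_sym perm_catC /= -hA0 perm_cons.
by move=> /perm_mem <-; rewrite mem_nseq => /andP[_ /eqP].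
Qed.

(** The number of completing pairs is [20 g^2] because one of the two chosen
    points is in the large group: the remaining five groups all have size [g].
    Two points in small groups would leave [36 g^2] pairs, which is always
    divisible by 6. *)
Lemma gdd_type_g6_3g_dvd (X : finType) (G B : {set {set X}}) (m g : nat) :
  0 < g -> is_gdd 4 5 m [:: (g, 6); (3 * g, 1)] G B -> 3 %| g.
Proof.
move=> g0 gddX; have partG := gdd_partition gddX.
have [A0 [A0G cA0] cG] := one_big_group gddX.
have cX : #|X| = 9 * g.
  by rewrite (gdd_points gddX) (gdd_order gddX) !big_cons big_nil /=; lia.
have /card_gt0P[x xA0] : 0 < #|A0| by rewrite cA0; lia.
have /card_gt0P[y] : 0 < #|~: A0| by have := cardsC A0; rewrite cA0 cX; lia.
rewrite inE => yA0.
have px : pblock G x = A0 by apply: group_pblock.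
have pN z : z \notin A0 -> pblock G z != A0.
  by apply: contraNneq => <-; apply: in_pblock.
have cN z : z \notin A0 -> #|pblock G z| = g.
  by move=> /pN; apply: cG; apply: pblock_group.
pose U := ~: (A0 :|: pblock G y).
have disj z w : pblock G z != pblock G w -> [disjoint pblock G z & pblock G w].
  move=> nzw; have /and3P[_ /trivIsetP tG _] := partG.
  by apply: tG => //; apply: pblock_group.
have cU : #|U| = 5 * g.
  have := cardsC (A0 :|: pblock G y); rewrite -/U cX cardsU.
  rewrite -px disjoint_setI0 ?px; last by rewrite -px disj // px eq_sym pN.
  by rewrite cards0 cA0 cN //; lia.
have UP z : (z \in U) = (pblock G z != A0) && (pblock G z != pblock G y).
  have memP C : C \in G -> (z \in C) = (pblock G z == C).
    by move=> CG; apply/idP/eqP=> [|<-]; [apply: group_pblock | apply: in_pblock].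
  by rewrite !inE negb_or !memP ?pblock_group.
have := dvdn_completing_pairs gddX (_ : pblock G x != pblock G y).
rewrite px eq_sym => /(_ (pN y yA0)).
rewrite (_ : #|_| = 20 * (g * g)); last first.
  clearbody U; pose Q u v := (v \in U) && (pblock G v != pblock G u).
  transitivity #|[set p : X * X | (p.1 \in U) && Q p.1 p.2]|.
    apply: eq_card => -[u v]; rewrite !inE /= /Q !UP px !inE !negb_or.
    rewrite !(eq_sym A0) (pN y yA0) !(eq_sym (pblock G y)) (eq_sym (pblock G v) (pblock G u)).
    by do 5!case: (_ == _).
  rewrite (card_dep_pairs (fun u => u \in U) Q) (eq_bigr (fun=> 4 * g)) => [|u uU].
    by rewrite sum_nat_const cU; lia.
  have : u \in U := uU; rewrite UP => /andP[uA0 uy].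
  have -> : [set v | Q u v] = U :\: pblock G u.
    apply/setP=> v; rewrite !inE /Q andbC; congr (~~ _ && _).
    by apply/eqP/idP=> [<-|]; [apply: in_pblock | apply: group_pblock; rewrite ?pblock_group].
  have sub : pblock G u \subset U.
    by apply/subsetP => v /(group_pblock partG (pblock_group partG u)); rewrite UP => ->; rewrite uA0.
  rewrite cardsD (setIidPr sub) cU cN; first by lia.
  by apply: contraNN uA0 => /(group_pblock partG A0G) ->.
rewrite (_ : 6 = 2 * 3) // => /(dvdn_trans (dvdn_mull 2 (dvdnn 3))).
by rewrite Gauss_dvdr // Euclid_dvdM // orbb.
Qed.

(** * Inflation by a finite abelian group *)

Definition inflate_type (h : nat) (ty : gdd_type) : gdd_type :=
  [seq (p.1 * h, p.2) | p <- ty].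

Lemma type_sizes_inflate h ty :
  type_sizes (inflate_type h ty) = [seq s * h | s <- type_sizes ty].
Proof.
elim: ty => [|[s n] ty IH] //=; rewrite /type_sizes /= in IH *.
by rewrite map_cat map_nseq IH.
Qed.

Section Inflation.

Variables (X : finType) (V : finZmodType) (G B : {set {set X}}).
Variables (t m : nat) (ty : gdd_type).
Hypothesis gddX : is_gdd t t.+1 m ty G B.

Let column (A : {set X}) : {set X * V} := [set p | p.1 \in A].
Let shadow (C : {set X * V}) : {set X} := [set p.1 | p in C].

Definition inflated_groups : {set {set X * V}} := column @: G.

(** Comparing the cardinals of [C] and of its projection, which is a block, shows
    that [C] has exactly one point above each point of that block. *)
Definition inflated_blocks : {set {set X * V}} :=
  [set C : {set X * V} | [&& shadow C \in B, #|C| == t.+1 & \sum_(p in C) p.2 == 0%R]%R].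

Let card_column A : #|column A| = #|A| * #|V|.
Proof.
rewrite -[#|V|]cardsT -cardsX; apply: eq_card => -[x v].
by rewrite !inE andbT.
Qed.

Let column_inj : injective column.
Proof.
move=> A A' eAA'; apply/setP => x.
by move/setP/(_ (x, 0%R)): eAA'; rewrite !inE.
Qed.

Let fst_inj C : C \in inflated_blocks -> {in C &, injective fst}.
Proof.
rewrite inE => /and3P[CB /eqP cC _]; apply/imset_injP.
by rewrite cC (gdd_block_size gddX CB).
Qed.

Let transverse_shadow S : transverse inflated_groups S ->
  {in S &, injective fst} /\ transverse G (shadow S).
Proof.
have partG := gdd_partition gddX => trS.
have same A p q : A \in G -> p \in S -> q \in S -> p.1 \in A -> q.1 \in A -> p = q.
  move=> AG pS qS pA qA.
  by apply: (card_le1_eqP (trS _ (imset_f column AG))); rewrite !inE ?pS ?qS.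
split=> [p q pS qS epq | A AG].
  by apply: (same _ _ _ (pblock_group partG p.1)); rewrite ?in_pblock // epq in_pblock.
apply/card_le1_eqP => _ _ /setIP[/imsetP[p pS ->] pA] /setIP[/imsetP[q qS ->] qA].
by rewrite (same A p q).
Qed.

(** The block size [t + 1] is what makes the lifts work: a transverse [t]-set
    projects to a [t]-set, whose block has a single further point [y], and the
    zero-sum condition leaves a single choice for the copy of [y]. *)
Lemma is_gdd_inflate :
  is_gdd t t.+1 (m * #|V|) (inflate_type #|V| ty) inflated_groups inflated_blocks.
Proof.
have partG := gdd_partition gddX; have /and3P[/eqP covG trivG nG0] := partG.
split.
- exact: gdd_t_ge2 gddX.
- rewrite (gdd_order gddX) big_map big_distrl; apply: eq_bigr => p _ /=.
  by rewrite mulnA.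
- by rewrite card_prod (gdd_points gddX).
- apply/and3P; split.
  + rewrite eqEsubset subsetT; apply/subsetP => p _; apply/bigcupP.
    exists (column (pblock G p.1)); last by rewrite inE in_pblock.
    by apply: imset_f; apply: pblock_group.
  + apply/trivIsetP => _ _ /imsetP[A AG ->] /imsetP[A' AG' ->] nAA'.
    rewrite -setI_eq0; apply/eqP/setP => p; rewrite !inE; apply/negP => /andP[pA pA'].
    by move: nAA'; rewrite -(group_pblock partG AG pA) (group_pblock partG AG' pA') eqxx.
  + apply: contra nG0 => /imsetP[A AG e0]; suff <- : A = set0 by [].
    by apply: column_inj; rewrite -e0; apply/setP => p; rewrite !inE.
- rewrite type_sizes_inflate.
  have /(perm_map (fun A : {set X * V} => #|A|)) := perm_enum_imset G column_inj.
  move/perm_trans; apply; rewrite -map_comp (eq_map card_column).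
  by rewrite (map_comp (muln^~ #|V|)) perm_map // (gdd_group_sizes gddX).
- by move=> C; rewrite inE => /and3P[_ /eqP].
- move=> C CB _ /imsetP[A AG ->]; apply/card_le1_eqP => p q.
  rewrite !inE => /andP[pC pA] /andP[qC qA]; apply: (fst_inj CB) => //.
  move: CB; rewrite inE => /and3P[CB _ _].
  by apply: (card_le1_eqP (gdd_block_transverse gddX CB AG)); rewrite !inE ?pA ?qA imset_f.
move=> S cS /transverse_shadow[injS trS].
have csh : #|shadow S| = t by rewrite card_in_imset.
have [b [[bB sb] ub]] := gdd_cover gddX csh trS.
have /cards1P[y yE] : #|b :\: shadow S| == 1.
  by rewrite cardsD (setIidPr sb) (gdd_block_size gddX bB) csh subSnn.
have [yb yS] : y \in b /\ y \notin shadow S.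
  by have : y \in b :\: shadow S by [rewrite yE set11]; rewrite inE => /andP[].
pose p : X * V := (y, - \sum_(q in S) q.2)%R.
have pS : p \notin S by apply: contra yS => /(imset_f fst).
(* The copy of the missing point is the one that makes the sum vanish. *)
exists (p |: S); split=> [|C [CB SC]].
  split; last exact: subsetUr.
  rewrite inE cardsU1 pS cS eqxx big_setU1 //= addNr eqxx andbT.
  rewrite /shadow imsetU1 -/(shadow S) -yE setUC -[X in _ :|: X]/(b :\: _).
  by rewrite setDE setUIr setUCr setIT (setUidPr sb).
have shC : shadow C = b.
  by apply/esym/ub; split; [move: CB; rewrite inE => /and3P[] | apply: imsetS].
have injC := fst_inj CB; move: CB; rewrite inE => /and3P[_ /eqP cC /eqP sumC].
have /cards1P[q qE] : #|C :\: S| == 1 by rewrite cardsD (setIidPr SC) cC cS subSnn.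
have /setDP[qC qS] : q \in C :\: S by rewrite qE set11.
have CE : C = q |: S by rewrite -qE setUC setDE setUIr setUCr setIT (setUidPr SC).
have q1 : q.1 = y.
  apply/set1P; rewrite -yE inE -shC (imset_f fst qC) andbT.
  apply: contra qS => /imsetP[r rS eqr].
  by rewrite (injC q r) //; apply: (subsetP SC).
have q2 : q.2 = p.2.
  by apply/eqP; rewrite /= -addr_eq0 -[X in _ == X]sumC CE big_setU1 //=.
by rewrite CE [q]surjective_pairing q1 q2.
Qed.

End Inflation.

Lemma gdd_exists_inflate h t m ty :
  0 < h -> gdd_exists t t.+1 m ty -> gdd_exists t t.+1 (m * h) (inflate_type h ty).
Proof.
case: h => // h _ [X [G [B gddX]]].
exists (X * 'I_h.+1)%type, (inflated_groups 'I_h.+1 G), (inflated_blocks 'I_h.+1 B t).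
by have := is_gdd_inflate 'I_h.+1 gddX; rewrite card_ord.
Qed.

(** * A design of type 3^6 9^1 *)

Section Fibres.

Variables (X I : finType) (k : X -> I).
Hypothesis surjk : forall i, exists x, k x = i.

Definition fibre (i : I) : {set X} := [set x | k x == i].

Definition fibres : {set {set X}} := fibre @: [set: I].

Lemma fibre_inj : injective fibre.
Proof.
move=> i j eij; have [x xi] := surjk i; move/setP/(_ x): eij.
by rewrite !inE xi eqxx => /esym/eqP.
Qed.

Lemma partition_fibres : partition fibres [set: X].
Proof.
apply/and3P; split.
- rewrite eqEsubset subsetT; apply/subsetP => x _; apply/bigcupP.
  by exists (fibre (k x)); rewrite ?imset_f // inE.
- apply/trivIsetP => _ _ /imsetP[i _ ->] /imsetP[j _ ->] nij.
  rewrite -setI_eq0; apply/eqP/setP => x; rewrite !inE; apply/negP => /andP[/eqP xi].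
  by rewrite xi => /eqP eij; rewrite eij eqxx in nij.
by apply/imsetP => -[i _] /setP e0; have [x xi] := surjk i; have := e0 x; rewrite !inE xi eqxx.
Qed.

Lemma fibre_sizes :
  perm_eq [seq #|A : {set X}| | A <- enum fibres] [seq #|fibre i| | i <- enum I].
Proof.
have := perm_map (fun A : {set X} => #|A|) (perm_enum_imset [set: I] fibre_inj).
by move/perm_trans; apply; rewrite -map_comp enum_setT -enumT.
Qed.

Lemma transverse_fibres (S : {set X}) :
  transverse fibres S <-> {in S &, injective k}.
Proof.
split=> [trS x y xS yS exy | injS _ /imsetP[i _ ->]].
  by apply: (card_le1_eqP (trS _ (imset_f fibre (in_setT (k x))))); rewrite !inE ?xS ?yS ?exy /=.
apply/card_le1_eqP => x y; rewrite !inE => /andP[xS /eqP xi] /andP[yS /eqP yi].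
by apply: injS => //; rewrite xi.
Qed.

End Fibres.

Section CoversOnce.

Variables (T I : eqType) (k : T -> I).

(** Filtering the blocks each time a point is chosen shares the work between
    subsets with a common beginning, which keeps the evaluation on all the
    transverse 4-subsets of 27 points short.  [seen] collects the labels of the
    points already chosen, and [t] is the number of points still to be chosen. *)
Fixpoint covers_once (t : nat) (seen : seq I) (pts : seq T) (bs : seq (seq T)) : bool :=
  if t is u.+1 then
    if pts is x :: pts' then
      covers_once t seen pts' bs &&
      ((k x \in seen) ||
       covers_once u (k x :: seen) pts' [seq b <- bs | x \in b])
    else true
  else size bs == 1.

Lemma covers_onceP t seen pts bs s :
  covers_once t seen pts bs -> subseq s pts -> size s = t -> uniq (map k s ++ seen) ->
  size [seq b <- bs | all [in b] s] = 1.
Proof.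
elim: pts t seen bs s => [|x pts IH] [|t] seen bs [|y s] //=.
- by move/eqP=> sbs _ _ _; rewrite filter_predT.
- by move/eqP=> sbs _ _ _; rewrite filter_predT.
move=> /andP[skip use] sub [ss] /andP[]; rewrite mem_cat negb_or => /andP[ys yseen] us.
have [exy | nxy] := eqVneq y x; last first.
  apply: (IH t.+1 seen bs (y :: s)) => //=; last 1 first.
    by rewrite mem_cat negb_or ys yseen us.
  - by move: sub; rewrite (negPf nxy).
  by rewrite ss.
subst y; move: use sub; rewrite (negPf yseen) eqxx /= => use sub.
rewrite -(IH t (k x :: seen) [seq b <- bs | x \in b] s) //; last first.
  by rewrite -cat1s uniq_catCA /= mem_cat negb_or ys yseen us.
by rewrite -filter_predI; congr size; apply: eq_filter => b /=; rewrite andbC.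
Qed.

End CoversOnce.

(** The points 0..8, 9..17 and 18..26 are the three copies of the residues
    modulo 9. *)
Definition point (part x : nat) : nat := 9 * part + x %% 9.

Definition group_of (p : nat) : nat := if p < 18 then 3 * (p %/ 9) + p %% 3 else 6.

(** All parts in the first two copies are centred at 0: they are the sets
    [{0}], [{-1, 1}], [{-4, 4}], [{-7, 7}] and [{-1, 0, 1}].  The third
    component is therefore the constant [c] attached to the half-differences. *)
Definition base_blocks : seq (seq nat * seq nat * nat) :=
  [:: ([:: 8; 0; 1], [:: 0], 0);
      ([:: 0], [:: 8; 0; 1], 1);
      ([:: 1; 8], [:: 1; 8], 6);
      ([:: 1; 8], [:: 4; 5], 8);
      ([:: 1; 8], [:: 7; 2], 4)].

Definition develop (b : seq nat * seq nat * nat) (s u v : nat) : seq nat :=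
  [seq point 0 (s * x + u) | x <- b.1.1]
  ++ [seq point 1 (s * y + v) | y <- b.1.2]
  ++ [:: point 2 (s * b.2 + (u + v))].

Definition developed_blocks : seq (seq nat) :=
  [seq develop bs.1 bs.2 uv.1 uv.2
  | bs <- [seq (b, s) | b <- base_blocks, s <- [:: 1; 4; 7]],
    uv <- [seq (u, v) | u <- iota 0 9, v <- iota 0 9]].

Lemma developed_blocks_cover : covers_once group_of 4 [::] (iota 0 27) developed_blocks.
Proof. by vm_compute. Qed.

Lemma developed_blocks_transverse :
  all (fun b => [&& all (gtn 27) b, size b == 5 & uniq (map group_of b)]) developed_blocks.
Proof. by vm_compute. Qed.

Definition ord_group (p : 'I_27) : 'I_7 := inord (group_of p).

Lemma val_ord_group p : val (ord_group p) = group_of p.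
Proof.
apply: inordK; have /allP := isT : all (fun q => group_of q < 7) (iota 0 27).
by apply; rewrite mem_iota ltn_ord.
Qed.

Lemma ord_group_surj i : exists p, ord_group p = i.
Proof.
have /allP/(_ (val i)) :=
  isT : all (fun j => has (fun q => group_of q == j) (iota 0 27)) (iota 0 7).
rewrite mem_iota ltn_ord => /(_ isT)/hasP[q]; rewrite mem_iota /= => q27 /eqP qi.
by exists (Ordinal q27); apply: val_inj; rewrite val_ord_group.
Qed.

Lemma card_ord_group i : #|fibre ord_group i| = count (fun q => group_of q == i) (iota 0 27).
Proof.
rewrite -val_enum_ord count_map enumT cardE /enum_mem size_filter.
by apply: eq_count => p /=; rewrite !inE -val_eqE val_ord_group.
Qed.

Definition block_set (b : seq nat) : {set 'I_27} := [set p | val p \in b].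

Lemma card_block_set b : uniq b -> all (gtn 27) b -> #|block_set b| = size b.
Proof.
move=> ub /allP b27; rewrite cardE -(size_map val); apply/perm_size/uniq_perm => //.
  by rewrite map_inj_uniq ?enum_uniq //; apply: val_inj.
move=> q; apply/mapP/idP => [[p]|qb]; first by rewrite mem_enum inE => pb ->.
by exists (Ordinal (b27 _ qb)); rewrite ?mem_enum ?inE.
Qed.

Lemma gdd_3_6_9_1 : gdd_exists 4 5 27 [:: (3, 6); (9, 1)].
Proof.
exists 'I_27, (fibres ord_group), [set B in map block_set developed_blocks].
have inB B : B \in [set B in map block_set developed_blocks] ->
  exists2 b, b \in developed_blocks & B = block_set b.
  by rewrite inE => /mapP.
split=> //.
- by rewrite !big_cons big_nil.
- by rewrite card_ord.
- exact: partition_fibres ord_group_surj.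
- apply: (perm_trans (fibre_sizes ord_group_surj)).
  rewrite (eq_map card_ord_group).
  rewrite (map_comp (fun i => count (fun q => group_of q == i) (iota 0 27)) val) val_enum_ord.
  by vm_compute.
- move=> _ /inB[b bb ->].
  have /and3P[b27 /eqP sb ub] := allP developed_blocks_transverse b bb.
  by rewrite card_block_set ?(map_uniq ub).
- move=> _ /inB[b bb ->].
  have /and3P[b27 /eqP sb ub] := allP developed_blocks_transverse b bb.
  apply/transverse_fibres => p q; rewrite !inE => pb qb /(congr1 val).
  by rewrite !val_ord_group => epq; apply/val_inj/(uniq_map_inj_in ub).
move=> S cS /transverse_fibres injS.
pose s := [seq val p | p <- enum S].
have : size [seq b <- developed_blocks | all [in b] s] = 1.
  apply: (covers_onceP developed_blocks_cover).
  - rewrite -val_enum_ord; apply: map_subseq; rewrite enumT; exact: filter_subseq.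
  - by rewrite size_map -cardE.
  rewrite cats0 -map_comp map_inj_in_uniq ?enum_uniq // => p q.
  rewrite !mem_enum => pS qS /= epq; apply: injS => //.
  by apply: val_inj; rewrite !val_ord_group.
have sub b : (S \subset block_set b) = all [in b] s.
  rewrite /s all_map; apply/subsetP/allP => sb p.
    by rewrite mem_enum => /sb; rewrite inE.
  by move=> pS; rewrite inE; apply: sb; rewrite mem_enum.
case E: [seq _ <- _ | _] => [|b []] // _.
have bP c : (c \in developed_blocks) && (S \subset block_set c) = (c == b).
  by rewrite sub andbC -(mem_filter (fun d : seq nat => all [in d] s)) E inE.
have /andP[bb sb] : (b \in developed_blocks) && (S \subset block_set b) by rewrite bP.
exists (block_set b); split=> [|_ [/inB[c cb ->] sc]].
  by split=> //; rewrite inE map_f.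
by have := bP c; rewrite cb sc => /esym/eqP->.
Qed.

Theorem corollary9 (g : nat) (hg : 0 < g) :
  gdd_exists 4 5 (6 * g + 3 * g) [:: (g, 6); (3 * g, 1)] <-> 3 %| g.
Proof.
split=> [[X [G [B]]] | /dvdnP[h def_g]]; first exact: gdd_type_g6_3g_dvd.
have h_gt0 : 0 < h by lia.
have := gdd_exists_inflate h_gt0 gdd_3_6_9_1.
rewrite /inflate_type /= def_g.
by rewrite (_ : 27 * h = 6 * (h * 3) + 3 * (h * 3)) 1?(_ : 9 * h = 3 * (h * 3)) 1?[3 * h]mulnC //; lia.
Qed.
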